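(* Let $K$ be a field, let $R := K[x,y]/\langle x\cdot y,\, x^2,\, y^2\rangle$, let $L$ be the $1$-dimensional Lie algebra over $K$ with basis $\{\alpha\}$, and let $E \in \mathrm{Der}_K(R)$ be the derivation with $E(x)=y$, $E(y)=0$. 1. There is a Lie-Rinehart algebra structure on $(R,L)$ whose $R$-module structure on $L$ is given by $x\cdot\alpha = y\cdot\alpha = 0$ and whose anchor map $\rho : L \to \mathrm{Der}_K(R)$ is given by $\rho(\alpha)=E$. 2. Let $V(R,L)$ be the enveloping algebra of the Lie-Rinehart algebra in 1. There is no right $V(R,L)$-module structure on $R$ that extends right multiplication in $R$. In particular, $V(R,L)$ is not a full Hopf algebroid, that is, the canonical left bialgebroid $V(R,L)$ over $R$ cannot be completed by a right bialgebroid structure and an antipode to a full Hopf algebroid.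
   Context: Unadorned $\otimes$ is the tensor product over $K$. Algebras are associative and unital, and algebra maps are unital. **Lie-Rinehart algebra.** It consists of a commutative $K$-algebra $R$, a Lie algebra $(L,[-,-]_L)$ over $K$, a left $R$-module structure $R\otimes L\to L$, $r\otimes\xi\mapsto r\cdot\xi$, on the $K$-vector space $L$, and an $R$-linear Lie algebra homomorphism $\rho: L\to \mathrm{Der}_K(R)$ (the anchor map) satisfying $[\xi, r\cdot\zeta]_L = r\cdot[\xi,\zeta]_L + \rho(\xi)(r)\cdot\zeta$ for all $r\in R$, $\xi,\zeta\in L$. Here $\mathrm{Der}_K(R)$ carries the commutator bracket and the $R$-module structure $(r\cdot D)(r')=r\,D(r')$. **Enveloping algebra.** $V(R,L)$ is Rinehart's enveloping algebra: the universal $K$-algebra equipped with a $K$-algebra map $R\to V(R,L)$ and a Lie algebra map $L\to (V(R,L),[-,-])$, $\xi\mapsto\bar\xi$ (with $[-,-]$ the commutator), such that $[\bar\xi,r]=\rho(\xi)(r)$ and $r\bar\xi=\overline{r\cdot\xi}$ for all $r\in R$, $\xi\in L$. It is generated by the images of these two maps. The map $R\to V(R,L)$ is injective, and elements of $R$ are identified with their images. A right $V(R,L)$-module structure on the $K$-vector space $R$ extends right multiplication in $R$ if each $r\in R\subset V(R,L)$ acts on $r'\in R$ by $r'\mapsto r'\cdot r$. **Left bialgebroid.** A left bialgebroid over a $K$-algebra $A$ is a $K$-algebra $H$ with algebra maps $s:A\to H$ (source) and $t:A^{\mathrm{op}}\to H$ (target) whose images commute, together with an $A$-coring structure $(\Delta,\epsilon)$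 on $H$ viewed as an $A$-bimodule via $a\cdot h\cdot a'=s(a)t(a')h$ (that is, coassociative and counital $A$-bimodule maps $\Delta:H\to H\otimes_A H$, $\epsilon:H\to A$), such that: $\Delta$ takes values in $\{\sum_i h_i\otimes h_i' : \sum_i h_i t(a)\otimes h'_i=\sum_i h_i\otimes h_i's(a)\ \forall a\in A\}$ and is an algebra map into this algebra with factorwise multiplication; $\epsilon(1)=1$; and $\epsilon(h\,s(\epsilon(h')))=\epsilon(hh')=\epsilon(h\,t(\epsilon(h')))$ for all $h,h'\in H$. **Right bialgebroid.** A right bialgebroid over a $K$-algebra $B$ is a $K$-algebra $H$ with algebra maps $s:B\to H$ and $t:B^{\mathrm{op}}\to H$ whose images commute, together with a $B$-coring structure $(\Delta,\epsilon)$ on $H$ viewed as a $B$-bimodule via $b\cdot h\cdot b'=h\,s(b')t(b)$, such that: $\Delta$ takes values in $\{\sum_i h_i\otimes h_i' : \sum_i s(b)h_i\otimes h'_i=\sum_i h_i\otimes t(b)h_i'\ \forall b\in B\}$ and is an algebra map into this algebra with factorwise multiplication; $\epsilon(1)=1$; and $\epsilon(s(\epsilon(h))h')=\epsilon(hh')=\epsilon(t(\epsilon(h))h')$ for all $h,h'\in H$. **Full Hopf algebroid** (in the sense of Böhm and Szlachányi). It consists of a $K$-algebra $H$, a left bialgebroid structure $(s_\ell,t_\ell,\Delta_\ell,\epsilon_\ell)$ on $H$ over some $K$-algebra $A$, a right bialgebroid structure $(s_r,t_r,\Delta_r,\epsilon_r)$ on $H$ over some $K$-algebra $B$, and a $K$-linear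 map $S:H\to H$ (the antipode), such that: (i) $s_\ell\epsilon_\ell t_r=t_r$, $t_\ell\epsilon_\ell s_r=s_r$, $s_r\epsilon_r t_\ell=t_\ell$, $t_r\epsilon_r s_\ell=s_\ell$; (ii) $(\Delta_\ell\otimes_B \mathrm{id})\Delta_r=(\mathrm{id}\otimes_A\Delta_r)\Delta_\ell$ and $(\Delta_r\otimes_A \mathrm{id})\Delta_\ell=(\mathrm{id}\otimes_B\Delta_\ell)\Delta_r$; (iii) $S(t_\ell(a)\,h\,t_r(b))=s_r(b)\,S(h)\,s_\ell(a)$ for all $a\in A$, $b\in B$, $h\in H$; (iv) $\mu\circ(S\otimes_A\mathrm{id})\circ\Delta_\ell=s_r\epsilon_r$ and $\mu\circ(\mathrm{id}\otimes_B S)\circ\Delta_r=s_\ell\epsilon_\ell$, where $\mu$ denotes the maps induced by multiplication in $H$. **Canonical left bialgebroid structure on $V(R,L)$.** It is over $A=R$; source and target are both the inclusion $R\to V(R,L)$; $\Delta(r)=r\otimes_R 1$ and $\Delta(\bar\xi)=\bar\xi\otimes_R 1+1\otimes_R\bar\xi$ for $r\in R$, $\xi\in L$; the counit is $\epsilon(u)=u\triangleright 1$, where $\triangleright$ is the left $V(R,L)$-module structure on $R$ in which $r\in R$ acts by left multiplication and $\bar\xi$ acts by $\rho(\xi)$. *)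

(* Defs.v *)
From HB Require Import structures.
From mathcomp Require Import all_boot all_algebra.
From mathcomp Require Import boolp.
From mathcomp Require Import freeg mpoly ring.

Set Implicit Arguments.
Unset Strict Implicit.
Unset Printing Implicit Defensive.

Import GRing.Theory.
Local Open Scope ring_scope.
Local Open Scope quotient_scope.

Section GeneratedSubspace.
Variables (K : fieldType) (V : lmodType K) (X : V -> Prop).

(* The intersection of the subspaces containing [X]. *)
Definition gen_subspace : {pred V} := fun v =>
  `[< forall S : V -> bool,
        GRing.submod_closed S -> (forall x, X x -> S x) -> S v >].

Lemma gen_subspace_closed : GRing.submod_closed gen_subspace.
Proof.
split; first by apply/asboolP => S [S0 _].
move=> c u v /asboolP uS /asboolP vS; apply/asboolP => S Scl SX.
by case: (Scl) => _; apply; [exact: uS | exact: vS].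
Qed.

HB.instance Definition _ :=
  GRing.isSubmodClosed.Build K V gen_subspace gen_subspace_closed.

Lemma mem_gen_subspace x : X x -> x \in gen_subspace.
Proof. by move=> Xx; apply/asboolP => S _; apply. Qed.

Definition quot_space := Quotient.quot gen_subspace.
HB.instance Definition _ := GRing.Zmodule.on quot_space.

Definition qscale (c : K) (u : quot_space) : quot_space :=
  \pi_quot_space (c *: repr u).

Lemma qscale_pi c (v : V) :
  qscale c (\pi_quot_space v) = \pi_quot_space (c *: v).
Proof.
apply/eqP; rewrite -Quotient.idealrBE -scalerBr rpredZ //.
by rewrite Quotient.idealrBE reprK.
Qed.

Fact qscaleA a b v : qscale a (qscale b v) = qscale (a * b) v.
Proof. by rewrite {2}/qscale qscale_pi scalerA. Qed.

Fact qscale1 : left_id 1 qscale.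
Proof. by move=> v; rewrite /qscale scale1r reprK. Qed.

Fact qscaleDr : right_distributive qscale +%R.
Proof.
move=> c u v; rewrite -[u]reprK -[v]reprK.
by rewrite -[in LHS]raddfD !qscale_pi scalerDr raddfD.
Qed.

Fact qscaleDl v : {morph qscale^~ v : a b / a + b}.
Proof. by move=> a b; rewrite /qscale scalerDl raddfD. Qed.

HB.instance Definition _ :=
  GRing.Zmodule_isLmodule.Build K quot_space qscaleA qscale1 qscaleDr qscaleDl.

End GeneratedSubspace.

Section Tensor.
Variables (K : fieldType) (M N : lmodType K) (A : Type).
Variables (ra : M -> A -> M) (la : A -> N -> N).

Inductive tens_rel : {freeg (M * N) / K} -> Prop :=
| TensDl m m' n : tens_rel (<<(m + m', n)>> - <<(m, n)>> - <<(m', n)>>)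
| TensDr m n n' : tens_rel (<<(m, n + n')>> - <<(m, n)>> - <<(m, n')>>)
| TensZl c m n : tens_rel (<<(c *: m, n)>> - c *: <<(m, n)>>)
| TensZr c m n : tens_rel (<<(m, c *: n)>> - c *: <<(m, n)>>)
| TensBal m a n : tens_rel (<<(ra m a, n)>> - <<(m, la a n)>>).

(* The tensor product over [A] of [M], with right action [ra], and [N], with
   left action [la]; [A] being a K-algebra acting K-linearly, it is a quotient
   of the tensor product over [K]. *)
Definition tens := quot_space tens_rel.
HB.instance Definition _ := GRing.Lmodule.on tens.

Definition tmk (m : M) (n : N) : tens := \pi_(quot_space tens_rel) <<(m, n)>>.

Section Lift.
Variables (P : lmodType K) (f : M -> N -> P).

(* The linear map on the tensor product induced by [f].  It is meaningful when
   [f] is bilinear and balanced, see [tliftE] and [tlift_linear]; otherwise the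
   value depends on the choice of a representative. *)
Definition tlift (u : tens) : P := fglift (fun p => f p.1 p.2) (repr u).

Record balanced : Prop := Balanced {
  bal_l : forall n, linear (f^~ n);
  bal_r : forall m, linear (f m);
  bal_m : forall m a n, f (ra m a) n = f m (la a n)
}.

Hypothesis fP : balanced.
Let F := fglift (fun p : M * N => f p.1 p.2).

Let FB : {morph F : D D' / D - D'}.
Proof. exact: lift_is_additive. Qed.

Let FD : {morph F : D D' / D + D'}.
Proof.
have F0 : F 0 = 0 by rewrite -(subr0 0) FB subrr.
by move=> D D'; rewrite -[D' in LHS]opprK FB -(sub0r D') FB F0 sub0r opprK.
Qed.

Let FZ c : {morph F : D / c *: D}.
Proof.
move=> D; elim/freeg_ind_dom0: D => [|k x D _ _ IH].
  by rewrite scaler0 -(subr0 0) FB subrr scaler0.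
rewrite scalerDr !FD scalerDr IH; congr (_ + _).
suff -> : c *: << k *g x >> = << c * k *g x >> :> {freeg (M * N) / K}.
  by rewrite /F !liftU scalerA.
by apply/eqP/freeg_eqP => y; rewrite coeffZ !coeffU mulrA.
Qed.

Let F_rel D : D \in gen_subspace tens_rel -> F D = 0.
Proof.
move=> /asboolP /(_ (fun D => F D == 0)) H; apply/eqP/H => {H D}.
  split=> [|c u v]; rewrite !unfold_in.
    by rewrite -(subr0 0) FB subrr.
  by move=> /eqP Fu /eqP Fv; rewrite FD FZ Fu Fv scaler0 addr0.
have FU m n : F <<(m, n)>> = f m n by rewrite /F liftU scale1r.
have lD m m' n : f (m + m') n = f m n + f m' n.
  by have := bal_l fP n 1 m m'; rewrite !scale1r.
have rD m n n' : f m (n + n') = f m n + f m n'.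
  by have := bal_r fP m 1 n n'; rewrite !scale1r.
have lZ c m n : f (c *: m) n = c *: f m n.
  have f0 : f 0 n = 0 by apply: (addIr (f 0 n)); rewrite -lD !add0r.
  by have := bal_l fP n c m 0; rewrite /= f0 !addr0.
have rZ c m n : f m (c *: n) = c *: f m n.
  have f0 : f m 0 = 0 by apply: (addIr (f m 0)); rewrite -rD !add0r.
  by have := bal_r fP m c n 0; rewrite /= f0 !addr0.
move=> _ [m m' n|m n n'|c m n|c m n|m a n]; rewrite !FB ?FZ !FU.
- by rewrite lD [_ + f m' n]addrC addrK subrr.
- by rewrite rD [_ + f m n']addrC addrK subrr.
- by rewrite lZ subrr.
- by rewrite rZ subrr.
- by rewrite (bal_m fP) subrr.
Qed.

Let tlift_pi D : tlift (\pi_(quot_space tens_rel) D) = F D.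
Proof.
apply/eqP; rewrite -subr_eq0 -[tlift _]/(F _) -FB; apply/eqP/F_rel.
by rewrite Quotient.idealrBE reprK.
Qed.

Lemma tliftE m n : tlift (tmk m n) = f m n.
Proof. by rewrite /tmk tlift_pi /F liftU scale1r. Qed.

Lemma tlift_linear : linear tlift.
Proof.
move=> c u v; rewrite -[u]reprK -[v]reprK.
rewrite [c *: _]qscale_pi -raddfD !tlift_pi.
by rewrite FD FZ.
Qed.

End Lift.
End Tensor.

Arguments tmk {K M N A ra la} m n.
Arguments tlift {K M N A ra la P} f u.

Section Rxy.
Variable K : fieldType.

Local Notation X := ('X_(@ord0 1) : {mpoly K[2]}).
Local Notation Y := ('X_(@ord_max 1) : {mpoly K[2]}).

Definition xy_ideal : {pred {mpoly K[2]}} := fun p =>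
  `[< exists a b c, p = a * (X * Y) + b * X ^+ 2 + c * Y ^+ 2 >].

Fact xy_ideal_closed : idealr_closed xy_ideal.
Proof.
split.
- by apply/asboolP; exists 0, 0, 0; rewrite !mul0r !addr0.
- apply/negP => /asboolP [a [b [c /(congr1 (mcoeff 0%MM))]]].
  move/eqP; rewrite mcoeff1 eqxx !mcoeffD.
  have M0 (u v : {mpoly K[2]}) : (u * v)@_0%MM = u@_0%MM * v@_0%MM.
    exact: (rmorphM (@mcoeff 2 K 0%MM)).
  have X0 i : ('X_i : {mpoly K[2]})@_0%MM = 0.
    by rewrite mcoeffX mnm1_eq0.
  by rewrite !expr2 !M0 !X0 !mulr0 !addr0 oner_eq0.
- move=> p u v /asboolP [a [b [c ->]]] /asboolP [a' [b' [c' ->]]].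
  apply/asboolP; exists (p * a + a'), (p * b + b'), (p * c + c').
  by rewrite !mulrDr !mulrDl !mulrA addrACA; congr (_ + _); rewrite addrACA.
Qed.

HB.instance Definition _ :=
  isIdealr.Build {mpoly K[2]} xy_ideal xy_ideal_closed.

Definition Rxy := {ideal_quot xy_ideal}.
HB.instance Definition _ := GRing.ComNzRing.on Rxy.

Definition xR : Rxy := \pi_{ideal_quot xy_ideal} X.
Definition yR : Rxy := \pi_{ideal_quot xy_ideal} Y.

Definition Rscale (c : K) (u : Rxy) : Rxy :=
  \pi_{ideal_quot xy_ideal} (c%:MP) * u.

Fact RscaleA a b v : Rscale a (Rscale b v) = Rscale (a * b) v.
Proof. by rewrite /Rscale mulrA mpolyCM rmorphM. Qed.

Fact Rscale1 : left_id 1 Rscale.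
Proof. by move=> v; rewrite /Rscale mpolyC1 rmorph1 mul1r. Qed.

Fact RscaleDr : right_distributive Rscale +%R.
Proof. by move=> c u v; rewrite /Rscale mulrDr. Qed.

Fact RscaleDl v : {morph Rscale^~ v : a b / a + b}.
Proof. by move=> a b; rewrite /Rscale mpolyCD raddfD mulrDl. Qed.

HB.instance Definition _ :=
  GRing.Zmodule_isLmodule.Build K Rxy RscaleA Rscale1 RscaleDr RscaleDl.

Fact RscaleAl (c : K) (u v : Rxy) : c *: (u * v) = (c *: u) * v.
Proof. exact: mulrA. Qed.

HB.instance Definition _ := GRing.Lmodule_isLalgebra.Build K Rxy RscaleAl.
HB.instance Definition _ := GRing.Lalgebra_isComAlgebra.Build K Rxy.

End Rxy.

Section LieRinehart.
Variables (K : fieldType) (R : comAlgType K) (L : lmodType K).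

Record lie_bracket := LieBracket {
  lie_br :> L -> L -> L;
  lie_br_linl : forall b, linear (lie_br^~ b);
  lie_br_linr : forall a, linear (lie_br a);
  lie_br_alt : forall a, lie_br a a = 0;
  lie_br_jacobi : forall a b c,
    lie_br a (lie_br b c) + lie_br b (lie_br c a) + lie_br c (lie_br a b) = 0
}.

Record derivation := Derivation {
  der_fun :> {linear R -> R};
  der_leibniz : forall r s, der_fun (r * s) = der_fun r * s + r * der_fun s
}.

Record lie_rinehart (br : lie_bracket) := LieRinehart {
  lr_act : R -> L -> L;
  lr_anchor : L -> derivation;
  lr_act_linl : forall a, linear (lr_act^~ a);
  lr_act_linr : forall r, linear (lr_act r);
  lr_act1 : forall a, lr_act 1 a = a;
  lr_actM : forall r s a, lr_act (r * s) a = lr_act r (lr_act s a);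
  lr_anchorD : forall a b r,
    lr_anchor (a + b) r = lr_anchor a r + lr_anchor b r;
  lr_anchorZ : forall r a s, lr_anchor (lr_act r a) s = r * lr_anchor a s;
  lr_anchor_br : forall a b r,
    lr_anchor (br a b) r
    = lr_anchor a (lr_anchor b r) - lr_anchor b (lr_anchor a r);
  lr_br_act : forall a r b,
    br a (lr_act r b) = lr_act r (br a b) + lr_act (lr_anchor a r) b
}.

Variables (br : lie_bracket) (LR : lie_rinehart br).

Record env_compat (V : algType K)
    (iR : {lrmorphism R -> V}) (iL : {linear L -> V}) : Prop := EnvCompat {
  env_br : forall a b, iL (br a b) = iL a * iL b - iL b * iL a;
  env_anchor : forall a r, iL a * iR r - iR r * iL a = iR (lr_anchor LR a r);
  env_act : forall r a, iR r * iL a = iL (lr_act LR r a)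
}.

Record enveloping := Enveloping {
  env_alg :> algType K;
  env_R : {lrmorphism R -> env_alg};
  env_L : {linear L -> env_alg};
  env_compatP : env_compat env_R env_L;
  env_univ : forall (W : algType K)
      (jR : {lrmorphism R -> W}) (jL : {linear L -> W}),
    env_compat jR jL ->
    exists f : {lrmorphism env_alg -> W},
      [/\ forall r, f (env_R r) = jR r,
          forall a, f (env_L a) = jL a
        & forall g : {lrmorphism env_alg -> W},
            (forall r, g (env_R r) = jR r) -> (forall a, g (env_L a) = jL a) ->
            g =1 f]
}.

End LieRinehart.

Section DerivationXY.
Variable K : fieldType.

Local Notation I := (@xy_ideal K).
Local Notation X := ('X_(@ord0 1) : {mpoly K[2]}).
Local Notation Y := ('X_(@ord_max 1) : {mpoly K[2]}).

Let dX : X^`M(ord0) = 1.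
Proof.
rewrite mderivX mnm1E eqxx scale1r -mpolyX0; congr 'X_[_].
by apply/mnmP => i; rewrite mnmBE subnn mnm0E.
Qed.

Let dY : Y^`M(ord0) = 0.
Proof. by rewrite mderivX mnm1E scale0r. Qed.

(* Induced by the derivation y d/dx of K[x,y]. *)
Let E (u : Rxy K) : Rxy K := \pi_{ideal_quot I} (Y * (repr u)^`M(ord0)).

Let E_pi (p : {mpoly K[2]}) :
  E (\pi_{ideal_quot I} p) = \pi_{ideal_quot I} (Y * p^`M(ord0)).
Proof.
apply/eqP; rewrite -Quotient.idealrBE -mulrBr -mderivB.
have : repr (\pi_{ideal_quot I} p) - p \in I.
  by rewrite Quotient.idealrBE reprK.
move=> /asboolP [a [b [c ->]]]; apply/asboolP.
exists (a^`M(ord0) * Y + b^`M(ord0) * X + b *+ 2), 0, (a + c^`M(ord0) * Y).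
rewrite !mderivD !mderivM dX dY; ring.
Qed.

Let E_linear : linear E.
Proof.
move=> c u v; rewrite -[u]reprK -[v]reprK.
have scE p : c *: (\pi_{ideal_quot I} p : Rxy K) = \pi_{ideal_quot I} (c *: p).
  by rewrite -mul_mpolyC rmorphM.
by rewrite scE -raddfD !E_pi scE -raddfD mderivD mderivZ mulrDr scalerAr.
Qed.

Let E_leibniz u v : E (u * v) = E u * v + u * E v.
Proof.
rewrite -[u]reprK -[v]reprK -rmorphM !E_pi -!rmorphM -raddfD mderivM.
by congr (\pi_{ideal_quot I} _); ring.
Qed.

Lemma derivation_xy_exists :
  exists E : derivation (Rxy K), E (xR K) = yR K /\ E (yR K) = 0.
Proof.
pose D : {linear Rxy K -> Rxy K} :=
  HB.pack E (GRing.isLinear.Build K (Rxy K) (Rxy K) *:%R E E_linear).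
exists (@Derivation _ _ D E_leibniz); split.
- by rewrite -[LHS]/(E _) E_pi dX mulr1.
- by rewrite -[LHS]/(E _) E_pi dY mulr0 raddf0.
Qed.

End DerivationXY.

Section Modules.
Variables (K : fieldType) (H : algType K) (M : lmodType K).

Record left_module (act : H -> M -> M) : Prop := LeftModule {
  lmod_linl : forall m, linear (act^~ m);
  lmod_linr : forall h, linear (act h);
  lmod_1 : forall m, act 1 m = m;
  lmod_M : forall h h' m, act (h * h') m = act h (act h' m)
}.

Record right_module (act : M -> H -> M) : Prop := RightModule {
  rmod_linl : forall h, linear (act^~ h);
  rmod_linr : forall m, linear (act m);
  rmod_1 : forall m, act m 1 = m;
  rmod_M : forall m h h', act m (h * h') = act (act m h) h'
}.

End Modules.

Section TensorMaps.
Variables (K : fieldType) (A B : Type).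

Definition tmap (M N M' N' : lmodType K)
    (ra : M -> A -> M) (la : A -> N -> N)
    (ra' : M' -> B -> M') (la' : B -> N' -> N')
    (f : M -> M') (g : N -> N') : tens ra la -> tens ra' la' :=
  tlift (fun m n => tmk (f m) (g n)).

Variables M N P : lmodType K.
Variables (ra : M -> A -> M) (la : A -> N -> N).
Variables (rb : N -> B -> N) (lb : B -> P -> P).

(* Right action on the second factor of [M (x) N] and left action on the first
   factor of [N (x) P]. *)
Definition tens_ract (u : tens ra la) (b : B) : tens ra la :=
  tlift (fun m n => tmk m (rb n b)) u.
Definition tens_lact (a : A) (v : tens rb lb) : tens rb lb :=
  tlift (fun n p => tmk (la a n) p) v.

(* The associativity isomorphism (M (x) N) (x) P -> M (x) (N (x) P). *)
Definition tassoc (w : tens tens_ract lb) : tens ra tens_lact :=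
  tlift (fun u p => tlift (fun m n => tmk m (tmk n p)) u) w.

End TensorMaps.

Arguments tmap {K A B M N M' N' ra la ra' la'} f g u.
Arguments tassoc {K A B M N P ra la rb lb} w.

Section Coring.
Variables (K : fieldType) (A : algType K) (M : lmodType K).
Variables (la : A -> M -> M) (ra : M -> A -> M).

Record coring := Coring {
  co_delta : {linear M -> tens ra la};
  co_eps : {linear M -> A};
  co_delta_lact : forall a m,
    co_delta (la a m) = tlift (fun h h' => tmk (la a h) h') (co_delta m);
  co_delta_ract : forall m a,
    co_delta (ra m a) = tlift (fun h h' => tmk h (ra h' a)) (co_delta m);
  co_eps_lact : forall a m, co_eps (la a m) = a * co_eps m;
  co_eps_ract : forall m a, co_eps (ra m a) = co_eps m * a;
  co_assoc : forall m,
    tassoc (tmap co_delta id (co_delta m)) = tmap id co_delta (co_delta m);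
  co_unitl : forall m, tlift (fun h h' => la (co_eps h) h') (co_delta m) = m;
  co_unitr : forall m, tlift (fun h h' => ra h (co_eps h')) (co_delta m) = m
}.

End Coring.

Section Bialgebroid.
Variables (K : fieldType) (A H : algType K).

(* Factorwise multiplication of elements of the tensor square of [H].  For a left
   bialgebroid, the outer lift is well defined because [u] lies in the Takeuchi
   product; for a right bialgebroid, because [v] does. *)
Definition ltens_mul (ra : H -> A -> H) (la : A -> H -> H)
    (u v : tens ra la) : tens ra la :=
  tlift (fun k k' => tlift (fun h h' => tmk (h * k) (h' * k')) u) v.
Definition rtens_mul (ra : H -> A -> H) (la : A -> H -> H)
    (u v : tens ra la) : tens ra la :=
  tlift (fun h h' => tlift (fun k k' => tmk (h * k) (h' * k')) v) u.

(* [lb_t] is an algebra map from the opposite algebra of [A]; [H] is the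
   A-bimodule a.h.a' = s(a) t(a') h, so that its tensor square identifies
   t(a) h (x) h' with h (x) s(a) h'. *)
Record left_bialgebroid := LeftBialgebroid {
  lb_s : {lrmorphism A -> H};
  lb_t : {linear A -> H};
  lb_t1 : lb_t 1 = 1;
  lb_tM : forall a b, lb_t (a * b) = lb_t b * lb_t a;
  lb_st : forall a b, lb_s a * lb_t b = lb_t b * lb_s a;
  lb_coring : coring (fun a h => lb_s a * h) (fun h a => lb_t a * h);
  lb_delta := co_delta lb_coring;
  lb_eps := co_eps lb_coring;
  lb_takeuchi : forall h a,
    tlift (fun k k' => tmk (k * lb_t a) k') (lb_delta h)
    = tlift (fun k k' => tmk k (k' * lb_s a)) (lb_delta h)
      :> tens (fun h a => lb_t a * h) (fun a h => lb_s a * h);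
  lb_delta1 : lb_delta 1 = tmk 1 1;
  lb_deltaM : forall h k,
    lb_delta (h * k) = ltens_mul (lb_delta h) (lb_delta k);
  lb_eps1 : lb_eps 1 = 1;
  lb_eps_s : forall h k, lb_eps (h * lb_s (lb_eps k)) = lb_eps (h * k);
  lb_eps_t : forall h k, lb_eps (h * lb_t (lb_eps k)) = lb_eps (h * k)
}.

(* Here the bimodule is b.h.b' = h s(b') t(b), and h s(b) (x) h' is identified
   with h (x) h' t(b). *)
Record right_bialgebroid := RightBialgebroid {
  rb_s : {lrmorphism A -> H};
  rb_t : {linear A -> H};
  rb_t1 : rb_t 1 = 1;
  rb_tM : forall a b, rb_t (a * b) = rb_t b * rb_t a;
  rb_st : forall a b, rb_s a * rb_t b = rb_t b * rb_s a;
  rb_coring : coring (fun b h => h * rb_t b) (fun h b => h * rb_s b);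
  rb_delta := co_delta rb_coring;
  rb_eps := co_eps rb_coring;
  rb_takeuchi : forall h b,
    tlift (fun k k' => tmk (rb_s b * k) k') (rb_delta h)
    = tlift (fun k k' => tmk k (rb_t b * k')) (rb_delta h)
      :> tens (fun h b => h * rb_s b) (fun b h => h * rb_t b);
  rb_delta1 : rb_delta 1 = tmk 1 1;
  rb_deltaM : forall h k,
    rb_delta (h * k) = rtens_mul (rb_delta h) (rb_delta k);
  rb_eps1 : rb_eps 1 = 1;
  rb_eps_s : forall h k, rb_eps (rb_s (rb_eps h) * k) = rb_eps (h * k);
  rb_eps_t : forall h k, rb_eps (rb_t (rb_eps h) * k) = rb_eps (h * k)
}.

End Bialgebroid.

(* In the mixed coassociativity laws, [tassoc] takes (H (x)_A H) (x)_B H to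
   H (x)_A (H (x)_B H), respectively (H (x)_B H) (x)_A H to
   H (x)_B (H (x)_A H).  The maps [tmap (lb_delta l) id] and so on are well
   defined by the first four conditions. *)
Record full_hopf_algebroid (K : fieldType) (A B H : algType K)
    (l : left_bialgebroid A H) (r : right_bialgebroid B H)
    (S : {linear H -> H}) : Prop := FullHopfAlgebroid {
  fh_sl_tr : forall b, lb_s l (lb_eps l (rb_t r b)) = rb_t r b;
  fh_tl_sr : forall b, lb_t l (lb_eps l (rb_s r b)) = rb_s r b;
  fh_sr_tl : forall a, rb_s r (rb_eps r (lb_t l a)) = lb_t l a;
  fh_tr_sl : forall a, rb_t r (rb_eps r (lb_s l a)) = lb_s l a;
  fh_coassoc_lr : forall h,
    tassoc (tmap (lb_delta l) id (rb_delta r h))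
    = tmap id (rb_delta r) (lb_delta l h);
  fh_coassoc_rl : forall h,
    tassoc (tmap (rb_delta r) id (lb_delta l h))
    = tmap id (lb_delta l) (rb_delta r h);
  fh_antipode : forall a h b,
    S (lb_t l a * h * rb_t r b) = rb_s r b * S h * lb_s l a;
  fh_antipodel : forall h,
    tlift (fun k k' => S k * k') (lb_delta l h) = rb_s r (rb_eps r h);
  fh_antipoder : forall h,
    tlift (fun k k' => k * S k') (rb_delta r h) = lb_s l (lb_eps l h)
}.

(* The structure is determined by these conditions, [V] being generated by the
   images of [R] and [L]. *)
Record canonical_bialgebroid (K : fieldType) (R : comAlgType K)
    (L : lmodType K) (br : lie_bracket L) (LR : lie_rinehart R br)
    (V : enveloping LR) (l : left_bialgebroid R V) : Prop := CanonicalBialg {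
  can_s : forall r, lb_s l r = env_R V r;
  can_t : forall r, lb_t l r = env_R V r;
  can_delta_R : forall r, lb_delta l (env_R V r) = tmk (env_R V r) 1;
  can_delta_L : forall a,
    lb_delta l (env_L V a) = tmk (env_L V a) 1 + tmk 1 (env_L V a);
  can_eps : exists act : V -> R -> R,
    [/\ left_module act,
        forall r s, act (env_R V r) s = r * s,
        forall a s, act (env_L V a) s = lr_anchor LR a s
      & forall u, lb_eps l u = act u 1]
}.

(* Main.v *)
Require Import Defs.
From HB Require Import structures.
From mathcomp Require Import all_boot all_algebra.
From mathcomp Require Import boolp freeg mpoly.

Set Implicit Arguments.
Unset Strict Implicit.
Unset Printing Implicit Defensive.

Import GRing.Theory.
Local Open Scope ring_scope.

(** Letting [R] act on [L] through the constant term gives a Lie-Rinehart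
    algebra because [E] takes values in [K y], on which [R] also acts through
    the constant term.
    In [V(R,L)] we have [x alpha = 0] and [alpha x - x alpha = E(x) = y], so
    [alpha x = y].  If [R] were a right [V(R,L)]-module extending
    multiplication and [a] the image of [1] under [alpha], then [a x = y].  As
    [R = K + Kx + Ky] with [x^2 = xy = 0], [a x = c x] for the constant term
    [c] of [a]; applying [E] gives [c y = 0], and [y <> 0] in [R], a
    contradiction.
    A full Hopf algebroid completion would yield such a module, through
    [r . h = eps_l (s_r (eps_r (t_l(r) h)))]. *)

Lemma derivation1 (K : fieldType) (R : comAlgType K) (D : derivation R) :
  D 1 = 0.
Proof.
by apply: (addIr (D 1)); rewrite add0r -{3}[1]mul1r der_leibniz mul1r mulr1.
Qed.

(** * Computations in [R]: constant terms and the spanning set [1], [x], [y] *)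

Section RxyTheory.
Variable K : fieldType.

Local Notation R := (Rxy K).
Local Notation x := (xR K).
Local Notation y := (yR K).
Local Notation piR := (\pi_{ideal_quot (@xy_ideal K)}%qT : {mpoly K[2]} -> R).

Lemma piZ c p : piR (c *: p) = c *: piR p.
Proof. by rewrite -mul_mpolyC rmorphM. Qed.

Lemma pi_xy_ideal p : piR p = 0 <-> p \in @xy_ideal K.
Proof.
by rewrite -[p in p \in _]subr0 Quotient.idealrBE raddf0; split=> [->|/eqP].
Qed.

Lemma xR_sqr : x * x = 0.
Proof.
rewrite -rmorphM; apply/pi_xy_ideal/asboolP; exists 0, 1, 0.
by rewrite !mul0r mul1r addr0 add0r expr2.
Qed.

Lemma yR_sqr : y * y = 0.
Proof.
rewrite -rmorphM; apply/pi_xy_ideal/asboolP; exists 0, 0, 1.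
by rewrite !mul0r mul1r !add0r expr2.
Qed.

Lemma xR_yR : x * y = 0.
Proof.
rewrite -rmorphM; apply/pi_xy_ideal/asboolP; exists 1, 0, 0.
by rewrite !mul0r mul1r !addr0.
Qed.

Lemma mcoeff0X i : ('X_i : {mpoly K[2]})@_0%MM = 0.
Proof. by rewrite mcoeffX mnm1_eq0. Qed.

Lemma mcoeff0M (p q : {mpoly K[2]}) : (p * q)@_0%MM = p@_0%MM * q@_0%MM.
Proof. exact: (rmorphM (@mcoeff 2 K 0%MM)). Qed.

(** The functional reading off the coefficient of [Y], written as the constant term of the
    [Y]-derivative, kills the ideal: by Leibniz, each term keeps a factor without constant term. *)
Lemma yR_neq0 : y != 0.
Proof.
apply/eqP => /pi_xy_ideal/asboolP [a [b [c]]].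
move=> /(congr1 (fun p : {mpoly K[2]} => (p^`M(ord_max))@_0%MM)).
rewrite !expr2 !(mderivD, mderivM) !(mcoeffD, mcoeff0M) !mcoeff0X.
rewrite !(mulr0, mul0r, addr0).
rewrite mderivX mnm1E eqxx scale1r mcoeffX.
set m := (_ - _)%MM; have -> : m = 0%MM.
  by apply/mnmP => i; rewrite mnmBE subnn mnm0E.
by move/eqP; rewrite eqxx oner_eq0.
Qed.

(** The choice of representative is immaterial, since elements of the ideal have no constant
    term. *)
Definition const_coef (u : R) : K := (repr u)@_0%MM.

Lemma const_coef_pi p : const_coef (piR p) = p@_0%MM.
Proof.
apply/eqP; rewrite -subr_eq0 -mcoeffB.
have : repr (piR p) - p \in @xy_ideal K by rewrite Quotient.idealrBE reprK.
move=> /asboolP [a [b [c ->]]].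
by rewrite !mcoeffD !expr2 !mcoeff0M !mcoeff0X !mulr0 !addr0.
Qed.

Lemma const_coefD u v : const_coef (u + v) = const_coef u + const_coef v.
Proof.
by rewrite -[u]reprK -[v]reprK -raddfD !const_coef_pi mcoeffD.
Qed.

Lemma const_coefM u v : const_coef (u * v) = const_coef u * const_coef v.
Proof.
by rewrite -[u]reprK -[v]reprK -rmorphM !const_coef_pi mcoeff0M.
Qed.

Lemma const_coef1 : const_coef 1 = 1.
Proof. by rewrite -(rmorph1 piR) const_coef_pi mcoeff1 eqxx. Qed.

Lemma const_coefy : const_coef y = 0.
Proof. by rewrite const_coef_pi mcoeff0X. Qed.

Lemma const_coefx : const_coef x = 0.
Proof. by rewrite const_coef_pi mcoeff0X. Qed.

Lemma const_coefZ c u : const_coef (c *: u) = c * const_coef u.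
Proof. by rewrite -[u]reprK -piZ !const_coef_pi mcoeffZ. Qed.

Lemma Rxy_affine u : exists a b c : K, u = a%:A + b *: x + c *: y.
Proof.
rewrite -[u]reprK.
elim/mpolyind: (repr u) => [|k m p _ _ [a [b [c IH]]]].
  by exists 0, 0, 0; rewrite raddf0 !scale0r !addr0.
have [a' [b' [c' Xm]]] : exists a b c : K, piR 'X_[m] = a%:A + b *: x + c *: y.
  rewrite mpolyXE_id big_ord_recl big_ord1 rmorphM !rmorphXn.
  have -> : fintype.lift ord0 ord0 = ord_max :> 'I_2 by apply/val_inj.
  rewrite -/x -/y.
  have nil (z : R) n : z * z = 0 -> z ^+ n.+2 = 0.
    by move=> z2; rewrite !exprS mulrA z2 mul0r.
  (* Each exponent is 0, 1 or at least 2; of the nine cases, six give zero and [1], [y], [x]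
     remain. *)
  case: (m ord0) (m ord_max) => [|[|i]] [|[|j]];
    rewrite ?expr0 ?expr1 ?(nil _ _ xR_sqr) ?(nil _ _ yR_sqr)
            ?xR_yR ?mulr1 ?mul1r ?mulr0 ?mul0r;
    try by exists 0, 0, 0; rewrite !scale0r !addr0.
  - by exists 1, 0, 0; rewrite !scale0r !addr0 scale1r.
  - by exists 0, 0, 1; rewrite !scale0r !add0r scale1r.
  - by exists 0, 1, 0; rewrite !scale0r add0r addr0 scale1r.
exists (k * a' + a), (k * b' + b), (k * c' + c).
have -> : piR (k *: 'X_[m] + p) = k *: piR 'X_[m] + piR p.
  by rewrite -piZ -raddfD.
rewrite Xm [piR p]IH !scalerDr !scalerA !scalerDl.
by rewrite addrACA; congr (_ + _); rewrite addrACA.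
Qed.

(** As [x] and [y] both annihilate [y], only the constant term survives. This makes the anchor
    [R]-linear. *)
Lemma mulRy u : u * y = const_coef u *: y.
Proof.
have [a [b [c ->]]] := Rxy_affine u.
rewrite !mulrDl -!scalerAl xR_yR yR_sqr mul1r !scaler0 !addr0.
rewrite !const_coefD !const_coefZ const_coefx const_coefy const_coef1.
by rewrite !mulr0 !addr0 mulr1.
Qed.

Lemma mulRx u : exists c : K, u * x = c *: x.
Proof.
have [a [b [c ->]]] := Rxy_affine u; exists a.
by rewrite !mulrDl -!scalerAl xR_sqr [y * x]mulrC xR_yR mul1r !scaler0 !addr0.
Qed.

Section Derivation.
Variables (E : derivation R) (Ex : E x = y) (Ey : E y = 0).

Lemma derivation_xy_line u : exists c : K, E u = c *: y.
Proof.
have [a [b [c ->]]] := Rxy_affine u; exists b.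
by rewrite !linearD !linearZ /= derivation1 Ex Ey !scaler0 add0r addr0.
Qed.

Lemma yR_notin_xR u : u * x <> y.
Proof.
have [c ->] := mulRx u => cxy.
have /eqP : c *: y = 0 by rewrite -Ex -linearZ cxy.
rewrite scaler_eq0 (negbTE yR_neq0) orbF => /eqP c0.
by move: yR_neq0; rewrite -cxy c0 scale0r eqxx.
Qed.

End Derivation.
End RxyTheory.

(** * The Lie-Rinehart structure *)

Lemma lie_bracket_dim1 (K : fieldType) (L : lmodType K) (br : lie_bracket L)
    (e : L) : (forall v, exists c : K, v = c *: e) -> forall u v, br u v = 0.
Proof.
move=> Le u v; have [a ->] := Le u; have [b ->] := Le v.
rewrite (scalable_linear (lie_br_linr br _)).
rewrite (scalable_linear (lie_br_linl br _)).
by rewrite /= lie_br_alt !scaler0.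
Qed.

Definition scale_derivation (K : fieldType) (R : comAlgType K) (c : K)
  (D : derivation R) : derivation R.
Proof.
exists (c \*: der_fun D) => r s /=.
by rewrite der_leibniz scalerDr scalerAl scalerAr.
Defined.

Lemma lie_rinehart_exists (K : fieldType) (L : vectType K)
    (br : lie_bracket L) (alpha : L) (alpha_basis : basis_of fullv [:: alpha])
    (E : derivation (Rxy K)) (Ex : E (xR K) = yR K) (Ey : E (yR K) = 0) :
  exists LR : lie_rinehart (Rxy K) br,
    [/\ lr_act LR (xR K) alpha = 0,
        lr_act LR (yR K) alpha = 0
      & forall r, lr_anchor LR alpha r = E r].
Proof.
pose k (v : L) := coord [tuple alpha] ord0 v.
have kE v : v = k v *: alpha.
  have := coord_basis alpha_basis (memvf v).
  by rewrite big_ord1.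
have k_alpha : k alpha = 1.
  by rewrite /k (coord_free ord0 ord0 (basis_free alpha_basis)).
have br0 : forall u v, br u v = 0.
  by apply: (@lie_bracket_dim1 _ _ _ alpha) => v; exists (k v).
pose act (r : Rxy K) (v : L) := const_coef r *: v.
(* The linear extension of [alpha |-> E]. *)
pose anchor v := scale_derivation (k v) E.
have kZ c v : k (c *: v) = c * k v by rewrite /k linearZ.
have kD u v : k (u + v) = k u + k v by rewrite /k linearD.
have act_linl a : linear (act^~ a).
  by move=> c r s; rewrite /act const_coefD const_coefZ scalerDl scalerA.
have act_linr r : linear (act r).
  by move=> c u v; rewrite /act scalerDr !scalerA mulrC.
have act1 a : act 1 a = a by rewrite /act const_coef1 scale1r.
have actM r s a : act (r * s) a = act r (act s a).
  by rewrite /act const_coefM scalerA.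
have anchorD a b r : anchor (a + b) r = anchor a r + anchor b r.
  by rewrite /= /anchor /= kD scalerDl.
have anchorZ r a s : anchor (act r a) s = r * anchor a s.
  rewrite /= kZ -scalerAr; have [c ->] := derivation_xy_line Ex Ey s.
  by rewrite -scalerAr mulRy !scalerA [k a * c * _]mulrC mulrA.
(* The bracket of [L] is zero, and two multiples of [E] commute. *)
have anchor_br a b r :
    anchor (br a b) r = anchor a (anchor b r) - anchor b (anchor a r).
  rewrite br0 /= [k 0]linear0 scale0r !linearZ /= !scalerA [k b * k a]mulrC.
  by rewrite scalerN subrr.
(* The last term vanishes too: [anchor a r] lies in [K y], so its constant term is 0. *)
have br_act a r b : br a (act r b) = act r (br a b) + act (anchor a r) b.
  rewrite !br0 /act scaler0 add0r /=.
  have [c ->] := derivation_xy_line Ex Ey r.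
  by rewrite !const_coefZ const_coefy !mulr0 scale0r.
exists (LieRinehart act_linl act_linr act1 actM anchorD anchorZ anchor_br br_act).
split=> [||r] /=.
- by rewrite /act const_coefx scale0r.
- by rewrite /act const_coefy scale0r.
- by rewrite k_alpha scale1r.
Qed.

(** * Right module structures on the base algebra *)

Lemma no_right_module (K : fieldType) (L : lmodType K) (br : lie_bracket L)
    (alpha : L) (E : derivation (Rxy K))
    (Ex : E (xR K) = yR K) (Ey : E (yR K) = 0)
    (LR : lie_rinehart (Rxy K) br) (V : enveloping LR) :
  lr_act LR (xR K) alpha = 0 ->
  (forall r, lr_anchor LR alpha r = E r) ->
  ~ exists act : Rxy K -> V -> Rxy K,
      right_module act /\ forall r r', act r' (env_R V r) = r' * r.
Proof.
move=> x_alpha anchorE [act [actP actR]].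
have alpha_x : env_L V alpha * env_R V (xR K) = env_R V (yR K).
  have := env_anchor (env_compatP V) alpha (xR K).
  by rewrite (env_act (env_compatP V)) x_alpha linear0 subr0 anchorE Ex.
apply: (yR_notin_xR Ex Ey (u := act 1 (env_L V alpha))).
by rewrite -actR -(rmod_M actP) alpha_x actR mul1r.
Qed.

(* [b . h := eps_r (s_r(b) h)] is a right [H]-module structure on [B], which is
   transported to [A] along the mutually inverse antihomomorphisms
   [eps_r t_l] and [eps_l s_r]. *)
Lemma full_hopf_right_module (K : fieldType) (A B H : algType K)
    (l : left_bialgebroid A H) (r : right_bialgebroid B H)
    (S : {linear H -> H}) :
  full_hopf_algebroid l r S -> (forall a, lb_eps l (lb_t l a) = a) ->
  exists act : A -> H -> A,
    right_module act /\
    forall a h, act a h = lb_eps l (rb_s r (rb_eps r (lb_t l a * h))).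
Proof.
move=> Hf eps_t.
exists (fun a h => lb_eps l (rb_s r (rb_eps r (lb_t l a * h)))); split=> //.
split=> [h c a b|a c h h'|a|a h h'].
- by rewrite linearP mulrDl -scalerAl !linearP.
- by rewrite mulrDr -scalerAr !linearP.
- by rewrite mulr1 (fh_sr_tl Hf) eps_t.
(* In the iterated action, [t_l eps_l s_r = s_r] leaves [eps_r (s_r (eps_r u) * h')] with
   [u = t_l(a) h], which equals [eps_r (u * h')]. *)
- by rewrite (fh_tl_sr Hf) rb_eps_s mulrA.
Qed.

Theorem theorem1p1 (K : fieldType)
    (L : vectType K) (br : lie_bracket L) (alpha : L)
    (alpha_basis : basis_of fullv [:: alpha])
    (E : derivation (Rxy K)) (Ex : E (xR K) = yR K) (Ey : E (yR K) = 0) :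
  (exists LR : lie_rinehart (Rxy K) br,
     [/\ lr_act LR (xR K) alpha = 0,
         lr_act LR (yR K) alpha = 0
       & forall r, lr_anchor LR alpha r = E r])
  /\
  (forall LR : lie_rinehart (Rxy K) br,
     lr_act LR (xR K) alpha = 0 ->
     lr_act LR (yR K) alpha = 0 ->
     (forall r, lr_anchor LR alpha r = E r) ->
     forall V : enveloping LR,
       ~ (exists act : Rxy K -> V -> Rxy K,
            right_module act /\
            forall r r', act r' (env_R V r) = r' * r)
       /\
       (forall l : left_bialgebroid (Rxy K) V,
          canonical_bialgebroid l ->
          ~ (exists (B : algType K) (r : right_bialgebroid B V)
                    (S : {linear V -> V}),
               full_hopf_algebroid l r S))).
Proof.
split; first exact: (lie_rinehart_exists br alpha_basis Ex Ey).
move=> LR x_alpha y_alpha anchorE V.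
have noV := no_right_module Ex Ey (V := V) x_alpha anchorE.
split=> // l lP [B [r [S Hf]]]; apply: noV.
have [acte [_ acteR _ epsE]] := can_eps lP.
have eps_t a : lb_eps l (lb_t l a) = a.
  by rewrite (can_t lP) epsE acteR mulr1.
have [act [actP actE]] := full_hopf_right_module Hf eps_t.
exists act; split=> // a a'.
(* The target is the inclusion of [R], so the product stays in its image, where [s_r eps_r] is the
   identity. *)
have tM : lb_t l a' * env_R V a = lb_t l (a' * a) by rewrite !(can_t lP) rmorphM.
by rewrite actE tM (fh_sr_tl Hf) eps_t.
Qed.
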